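(* There exists a constant $C>0$ such that for every compact connected surface $M$ with $H_1(M,\mathbb{Z}_2)\neq 0$ and every triangulation $S$ of $M$, the homological quantum error correcting code defined by $(M,S,S^* )$, with parameters $[[n,k,d]]$, satisfies $$d^2\le C\cdot n .$$
   Context: A compact surface is a 2-dimensional compact manifold without boundary. Let $S$ be a triangulation of $M$, let $S_i$ be its set of $i$-simplices, and let $C_i$ be the $\mathbb{Z}_2$-vector space with basis $S_i$, with boundary maps $\partial_i:C_i\to C_{i-1}$. Put $Z_1=\ker\partial_1$ (cycles) and $B_1=\operatorname{Im}\partial_2$ (boundaries), both subspaces of $C_1\cong\mathbb{Z}_2^{n}$ with $n=|S_1|$. Equip $\mathbb{Z}_2^n$ with the bilinear form $a\cdot b=\sum_i a_ib_i$; $\perp$ is taken with respect to it. $S^*$ denotes the Poincaré dual cell decomposition of $S$, whose $i$-cells correspond bijectively to the $(2-i)$-simplices of $S$. The homological code defined by $(M,S,S^* )$ is the CSS code associated with the two orthogonal subspaces $B_1$ and $Z_1^\perp$ of $\mathbb{Z}_2^n$. Its parameters $[[n,k,d]]$ are: $n=|S_1|$ (the number of edges of $S$), $k=\dim H_1(M,\mathbb{Z}_2)$, and $d$ is the minimal Hamming weight of a vector of $\mathbb{Z}_2^n$ lying in $(Z_1\setminus B_1)\cup(B_1^\perp\setminus Z_1^\perp)$. Equivalently, $d=\min\{csys_1(M,S),csys_1(M,S^* )\}$, where for a cell structure $T$ on $M$, $csys_1(M,T)$ is the minimal number of 1-cells in the support of a cellular $\mathbb{Z}_2$ 1-cycle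 of $T$ that is not homologous to zero. *)

(* Defs.v *)
From HB Require Import structures.
From mathcomp Require Import all_boot all_order all_algebra.
From mathcomp Require Import all_classical all_reals all_analysis.

Set Implicit Arguments.
Unset Strict Implicit.
Unset Printing Implicit Defensive.

Import Order.TTheory GRing.Theory Num.Theory.
Import numFieldNormedType.Exports.

Local Open Scope classical_set_scope.
Local Open Scope ring_scope.

Definition homeomorphic (X Y : topologicalType) (A : set X) (B : set Y) : Prop :=
  exists (f : X -> Y) (g : Y -> X),
    [/\ {within A, continuous f} /\ {within B, continuous g},
        {homo f : x / A x >-> B x},
        {homo g : y / B y >-> A y},
        forall x, A x -> g (f x) = x
      & forall y, B y -> f (g y) = y].

Definition locally_euclidean (R : realType) (n : nat) (M : topologicalType) : Prop :=
  forall x : M, exists (U : set M) (W : set 'rV[R]_n),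
    [/\ open U, U x, open W & homeomorphic U W].

(* Second countability is automatic for a compact locally Euclidean space. *)
Definition compact_surface (R : realType) (M : topologicalType) : Prop :=
  [/\ hausdorff_space M, compact [set: M] & locally_euclidean R 2 M].

(* A finite abstract simplicial complex whose vertices are (some of the)
   elements of 'I_m; finiteness is no restriction over a compact space. *)
Definition simplicial_complex (m : nat) (S : {set {set 'I_m}}) : Prop :=
  finset.set0 \notin S /\
  forall s t : {set 'I_m},
    s \in S -> t \subset s -> t != finset.set0 -> t \in S.

(* Points in barycentric coordinates, supported on a simplex. *)
Definition realization (R : realType) (m : nat) (S : {set {set 'I_m}}) :
    set 'rV[R]_m :=
  [set x | [/\ forall i, 0 <= x 0 i, \sum_i x 0 i = 1
             & [set i | x 0 i != 0]%SET \in S]].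

Definition triangulation (R : realType) (M : topologicalType) (m : nat)
    (S : {set {set 'I_m}}) : Prop :=
  simplicial_complex S /\ homeomorphic (@realization R m S) [set: M].

Section Chains.
Variables (m : nat) (S : {set {set 'I_m}}).

Definition simplices (i : nat) : {set {set 'I_m}} :=
  [set s in S | #|s| == i.+1]%SET.

(* An i-chain is a row vector in 'rV['F_2]_#|simplices i|, coordinate j being
   the coefficient of the simplex enum_val j; the boundary map from
   (i+1)-chains to i-chains is right multiplication by [boundary i]. *)
Definition boundary (i : nat) :
    'M['F_2]_(#|simplices i.+1|, #|simplices i|) :=
  \matrix_(s < #|simplices i.+1|, t < #|simplices i|)
    (enum_val t \subset enum_val s)%:R.

Definition cycles := kermx (boundary 0).
Definition boundaries := boundary 1.

Lemma boundary_boundary (i : nat) :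
  simplicial_complex S -> boundary i.+1 *m boundary i = 0.
Proof.
move=> cplxS.
apply/matrixP => a b; rewrite !mxE.
under eq_bigr do rewrite !mxE -natrM mulnb.
set s := enum_val a; set v := enum_val b.
have := enum_valP a; rewrite -/s inE => /andP[sS /eqP s_card].
have := enum_valP b; rewrite -/v inE => /andP[vS /eqP v_card].
rewrite -(big_enum_val (fun e : {set 'I_m} => ((e \subset s) && (v \subset e))%:R)) /=.
have [vs|vs] := boolP (v \subset s); last first.
  apply: big1 => e _; case: andP => // -[es ve].
  by rewrite (fintype.subset_trans ve es) in vs.
rewrite -natr_sum -big_mkcondr sum1_card.
suff -> : #|[pred e in simplices i.+1 | (e \subset s) && (v \subset e)]|
        = #|[set (x |: v) | x in s :\: v]%SET|.
  rewrite card_in_imset; last first.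
    move=> x y; rewrite !inE => /andP[xv _] /andP[yv _] /setP/(_ x).
    by rewrite !finset.in_setU1 eqxx (negbTE xv) !orbF => /esym/eqP.
  by rewrite cardsDS // s_card v_card !subSS -(addn2 i) addKn; apply/eqP.
apply: eq_card => e; rewrite !inE; apply/idP/imsetP.
  case/andP=> /andP[_ /eqP e_card] /andP[es ve].
  have /cards1P[x ex] : #|(e :\: v)%SET| == 1%N.
    by rewrite cardsDS // e_card v_card !subSS subSn // subnn.
  have xev : x \in (e :\: v)%SET by rewrite ex inE.
  exists x.
    by move: xev; rewrite !inE => /andP[-> /(fintype.subsetP es)].
  by rewrite -{1}(finset.setID e v) (finset.setIidPr ve) ex finset.setUC.
case=> x; rewrite inE => /andP[xv xs] ->.
have es : (x |: v)%SET \subset s by rewrite finset.subUset finset.sub1set xs.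
have ec : #|(x |: v)%SET| = i.+2 by rewrite cardsU1 xv v_card.
rewrite es finset.subsetUr ec eqxx !andbT; apply: cplxS.2 sS es _.
by rewrite -card_gt0 ec.
Qed.

Lemma boundaries_sub_cycles :
  simplicial_complex S -> (boundaries <= cycles)%MS.
Proof. by move=> cplxS; apply/sub_kermxP; exact: boundary_boundary. Qed.

Definition dim_H1 : nat := (\rank cycles - \rank boundaries)%N.

End Chains.

Definition dot (n : nat) (a b : 'rV['F_2]_n) : 'F_2 :=
  \sum_i a 0 i * b 0 i.

Definition orthogonal_to (n p : nat) (A : 'M['F_2]_(p, n)) (a : 'rV['F_2]_n) :
    bool :=
  [forall b : 'rV['F_2]_n, (b <= A)%MS ==> (dot a b == 0)].

Definition hamming_weight (n : nat) (a : 'rV['F_2]_n) : nat :=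
  #|[set i | a 0 i != 0]%SET|.

Section HomologicalCode.
Variables (m : nat) (S : {set {set 'I_m}}).

Definition code_length : nat := #|simplices S 1|.

Definition logical (a : 'rV['F_2]_code_length) : bool :=
     ((a <= cycles S)%MS && ~~ (a <= boundaries S)%MS)
  || (orthogonal_to (boundaries S) a && ~~ orthogonal_to (cycles S) a).

(* The neutral element code_length.+1 exceeds every Hamming weight, so this is
   the minimum as soon as there is a vector to minimize over, i.e. H_1 <> 0. *)
Definition code_distance : nat :=
  \big[minn/code_length.+1]_(a | logical a) hamming_weight a.

Definition homological_code_parameters : nat * nat * nat :=
  (code_length, dim_H1 S, code_distance).

End HomologicalCode.

(* Main.v *)
Require Import Defs.
From mathcomp Require Import all_classical all_reals all_analysis.
From mathcomp Require Import all_boot all_order all_algebra.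
From mathcomp Require Import zify.

Set Implicit Arguments.
Unset Strict Implicit.
Unset Printing Implicit Defensive.

Import Order.TTheory GRing.Theory Num.Theory.
Import numFieldNormedType.Exports.
Local Open Scope ring_scope.

(** The code distance is controlled by a level-set argument on the graph formed
    by the vertices and edges of S; a walk in it carries the mod 2 chain of its
    edges.

    Let g be a shortest closed walk whose chain is not a boundary, of length L,
    based at v.  Its chain is an essential cycle of weight at most L, so d <= L.
    By minimality g is isometrically embedded: a walk joining two of its
    vertices that is shorter than both arcs between them would split g into
    two shorter closed walks whose chains add up to that of g, so that one of
    them would be essential ([no_shortcut]).

    Let B be the ball of radius r around v in the graph metric, 2r + 2 <= L.
    Exactly two steps of g leave or enter B, namely ab at time r and b'a' at
    time L - r - 1.  Consider the set E of edges with exactly one end in B.  A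
    triangle contains zero or two edges of E, so if edges of E in a common
    triangle are called linked, the indicator of each class K of the generated
    equivalence is a cocycle.  Take the class K of ab.
    - If b'a' is not in K, then K meets g exactly once.  Hence its indicator is
      a cocycle which is not orthogonal to the cycle g, and #|K| >= d.
    - If b'a' is in K, follow a simple chain of linked edges from ab to b'a'.
      Consecutive edges lie in a common triangle, so that their ends inside B
      are equal or adjacent; this gives a walk from a to a' shorter than #|K|,
      whence #|K| > min(2r, L - 2r) since g has no shortcut.

    In both cases E has at least min(d, 2r, L - 2r) edges
    ([leq_card_crossing_ball]).  These sets are disjoint for distinct radii, and
    summing over the q radii between q and 2q, with q = d / 6, yields
    2 q^2 <= n, hence a bound quadratic in d. *)

(** * Walks and their chains *)

Lemma addrr_F2 n (c : 'rV['F_2]_n) : c + c = 0.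
Proof. by rewrite -mulr2n -scaler_nat (_ : 2%:R = 0 :> 'F_2) ?scale0r //; apply: val_inj. Qed.

Section Complex.
Variables (m : nat) (S : {set {set 'I_m}}).
Hypothesis cplxS : simplicial_complex S.

Definition simplex_chain i (s : {set 'I_m}) : 'rV['F_2]_#|simplices S i| :=
  \row_j (enum_val j == s)%:R.

Lemma simplex_chainE i s : s \in simplices S i ->
  exists2 j, enum_val j = s & simplex_chain i s = delta_mx 0 j.
Proof.
move=> sS; exists (enum_rank_in sS s); first by rewrite enum_rankK_in.
apply/rowP => j; rewrite !mxE eqxx /=; congr (_ %:R).
by rewrite -(inj_eq enum_val_inj) enum_rankK_in.
Qed.

Lemma boundary_simplex_chain i s : s \in simplices S i.+1 ->
  simplex_chain i.+1 s *m boundary S i = \sum_(x in s) simplex_chain i (s :\ x).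
Proof.
move=> sS; have [j js ->] := simplex_chainE sS.
rewrite -rowE; apply/rowP => k; rewrite !mxE js summxE.
under eq_bigr do rewrite mxE.
have := enum_valP k; have := sS; rewrite !inE => /andP[_ /eqP cs] /andP[_ /eqP ck].
case: (boolP (_ \subset s)) => [ks|ks]; last first.
  rewrite big1 // => x _; case: eqP => // e; move: ks.
  by rewrite e subD1set.
have /cards1P[x ex] : #|s :\: enum_val k| == 1%N.
  by rewrite cardsDS // cs ck subSn // subnn.
have : x \in s :\: enum_val k by rewrite ex inE.
rewrite inE => /andP[xk xs].
rewrite (bigD1 x) //= big1 ?addr0 => [|y /andP[ys yx]].
  rewrite (_ : _ == _ = true) //; apply/eqP/esym.
  by rewrite -ex setDDr setDv set0U; apply/setIidPr.
case: eqP => // e; move: yx; suff : y \in [set x] by rewrite inE => ->.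
by rewrite -ex e !inE ys eqxx.
Qed.

Definition adj : rel 'I_m := fun x y => (x != y) && ([set x; y] \in S).

Lemma adj_sym : symmetric adj.
Proof. by move=> x y; rewrite /adj eq_sym setUC. Qed.

Lemma adj_simplex x y : adj x y = (x != y) && ([set x; y] \in simplices S 1).
Proof. by rewrite /adj inE cards2; case: (x == y); rewrite ?andbF ?andbT. Qed.

(** The chain is kept as an index rather than computed from a list of vertices:
    only the length, the ends and the chain of a walk matter below. *)
Inductive walk : nat -> 'I_m -> 'I_m -> 'rV['F_2]_(code_length S) -> Prop :=
| walk_nil x : walk 0 x x 0
| walk_cons n x y z c : adj x y -> walk n y z c ->
    walk n.+1 x z (simplex_chain 1 [set x; y] + c).

Lemma walk_inv n x z c : walk n x z c ->
  if n isn't n'.+1 then x = z /\ c = 0 else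
  exists y c', [/\ adj x y, walk n' y z c' & c = simplex_chain 1 [set x; y] + c'].
Proof. by case=> // {}n {}x y {}z {}c xy w; exists y, c. Qed.

Lemma walk1 x y : adj x y -> walk 1 x y (simplex_chain 1 [set x; y]).
Proof. by move=> xy; rewrite -[simplex_chain _ _]addr0; apply: walk_cons (walk_nil _). Qed.

Lemma walk1E x y c : walk 1 x y c -> adj x y /\ c = simplex_chain 1 [set x; y].
Proof. by case/walk_inv => z [c' [xz /walk_inv[<- ->] ->]]; rewrite addr0. Qed.

Lemma walk_cat n1 n2 x y z c1 c2 :
  walk n1 x y c1 -> walk n2 y z c2 -> walk (n1 + n2) x z (c1 + c2).
Proof.
elim=> [t|n u v w c uv _ IH] w2; first by rewrite add0r.
by rewrite addSn -addrA; apply: walk_cons (IH w2).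
Qed.

Lemma walk_rev n x y c : walk n x y c -> walk n y x c.
Proof.
elim=> [t|{}n u v w {}c uv _ IH]; first exact: walk_nil.
rewrite -addn1 addrC; apply: walk_cat IH _.
by rewrite setUC; apply: walk1; rewrite adj_sym.
Qed.

Lemma walk_split n1 n2 x z c : walk (n1 + n2) x z c ->
  exists y c1 c2, [/\ walk n1 x y c1, walk n2 y z c2 & c = c1 + c2].
Proof.
elim: n1 x c => [|n1 IH] x c w.
  by exists x, 0, c; split; rewrite ?add0r //; exact: walk_nil.
have [y [c' [xy /IH[t [c1 [c2 [w1 w2 ->]]]] ->]]] := walk_inv w.
exists t, (simplex_chain 1 [set x; y] + c1), c2; split => //.
  exact: walk_cons.
exact: addrA.
Qed.

Lemma boundary_walk n x y c : walk n x y c ->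
  c *m boundary S 0 = simplex_chain 0 [set x] + simplex_chain 0 [set y].
Proof.
elim=> [t|{}n u v w {}c uv _ IH]; first by rewrite mul0mx addrr_F2.
move: uv; rewrite adj_simplex => /andP[uv uvS].
rewrite mulmxDl IH boundary_simplex_chain // big_setU1 ?inE //= big_set1.
rewrite (_ : _ :\ u = [set v]); last first.
  by apply/setP => t; rewrite !inE; have [->|] := eqVneq t u; rewrite ?(negPf uv).
rewrite (_ : _ :\ v = [set u]); last first.
  apply/setP => t; rewrite !inE; have [->|] := eqVneq t v; rewrite ?orbF //.
  by rewrite eq_sym (negPf uv).
by rewrite [X in X + _]addrC addrA -(addrA (simplex_chain 0 [set u])) addrr_F2 addr0.
Qed.

Lemma hamming_weightD n (a b : 'rV['F_2]_n) :
  (hamming_weight (a + b) <= hamming_weight a + hamming_weight b)%N.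
Proof.
rewrite /hamming_weight -cardsUI (leq_trans _ (leq_addr _ _)) //.
apply/subset_leq_card/subsetP => i; rewrite !inE mxE.
by have [->|] := eqVneq (a 0 i) 0; rewrite ?add0r ?orbT.
Qed.

Lemma weight_walk n x y c : walk n x y c -> (hamming_weight c <= n)%N.
Proof.
elim=> [t|{}n u v w {}c uv _ IH].
  by rewrite leqn0 cards_eq0; apply/eqP/setP => i; rewrite !inE mxE eqxx.
apply: leq_trans (hamming_weightD _ _) _; rewrite -[n.+1]add1n leq_add //.
move: uv; rewrite adj_simplex => /andP[_ /simplex_chainE[j _ ->]].
suff : (hamming_weight ('e_j : 'rV['F_2]_(code_length S)) <= #|[set j]|)%N.
  by rewrite cards1.
apply/subset_leq_card/subsetP => k.
by rewrite !inE mxE eqxx /=; case: (k == j).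
Qed.

(** * Essential closed walks *)

Lemma connect_walk x y : connect adj x y -> exists n c, walk n x y c.
Proof.
case/connectP => p; elim: p x => [|z p IH] x /=.
  by move=> _ ->; exists 0%N, 0; exact: walk_nil.
case/andP => xz zp /(IH z zp)[n [c w]].
by exists n.+1, (simplex_chain 1 [set x; z] + c); exact: walk_cons.
Qed.

Definition essential (c : 'rV['F_2]_(code_length S)) := ~~ (c <= boundaries S)%MS.

Lemma essentialD c1 c2 : essential (c1 + c2) -> essential c1 \/ essential c2.
Proof.
rewrite /essential; case: (boolP (c1 <= _)%MS) => h1; last by left.
case: (boolP (c2 <= _)%MS) => h2; last by right.
by rewrite addmx_sub.
Qed.

(** Fix in each component a base point and walks P x from it to the vertices x.
    A cycle z is the sum, over its edges xy, of the closed walks that follow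
    P x, then xy, then P y backwards, because the contributions of the P x add
    up to the image of the boundary of z, which is zero.  So if no closed walk is essential,
    neither is z. *)
Lemma essential_closed_walk (z : 'rV_(code_length S)) :
  (z <= cycles S)%MS -> essential z ->
  exists n v c, walk n v v c /\ essential c.
Proof.
move=> /sub_kermxP zZ; apply: contraNP => noloop.
have csym : connect_sym adj by apply: sym_connect_sym; exact: adj_sym.
have /boolp.choice[P PP] x : exists c n, walk n (fingraph.root adj x) x c.
  have [|n [c w]] := @connect_walk (fingraph.root adj x) x; last by exists c, n.
  by rewrite csym fingraph.connect_root.
(* The linear map from 0-chains to 1-chains sending a vertex x to P x. *)
pose Q : 'M['F_2]_(#|simplices S 0|, code_length S) :=
  \matrix_(i < #|simplices S 0|) \sum_(x in (enum_val i : {set 'I_m})) P x.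
have QE x : [set x] \in S -> simplex_chain 0 [set x] *m Q = P x.
  move=> xS; have [|i ix ->] := @simplex_chainE 0 [set x].
    by rewrite inE xS cards1.
  by rewrite -rowE rowK ix big_set1.
rewrite -[z]mulmx1 -[z *m 1%:M]addr0 -(mul0mx _ Q) -zZ -mulmxA -mulmxDr.
apply: mulmx_sub; apply/row_subP => j.
have := enum_valP j; rewrite !inE => /andP[eS] /cards2P[x [y [xy e]]].
have xyA : adj x y by rewrite /adj xy -e.
have e1 : row j 1%:M = simplex_chain 1 [set x; y].
  by rewrite rowE mulmx1; apply/rowP => k; rewrite !mxE -e (inj_eq enum_val_inj).
have xS : [set x] \in S.
  by apply: cplxS.2 eS _ _; rewrite ?e ?subsetUl // -card_gt0 cards1.
have yS : [set y] \in S.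
  by apply: cplxS.2 eS _ _; rewrite ?e ?subsetUr // -card_gt0 cards1.
have -> : row j (1%:M + boundary S 0 *m Q) = P x + (simplex_chain 1 [set x; y] + P y).
  rewrite linearD /= row_mul e1 addrCA; congr (_ + _).
  rewrite -[boundary S 0]mul1mx row_mul e1 (boundary_walk (walk1 xyA)) mulmxDl.
  by rewrite !QE.
case: (PP x) => n1 w1; case: (PP y) => n2 w2.
rewrite -[(_ <= _)%MS]negbK; apply/negP => ess; apply: noloop.
exists (n1 + n2.+1)%N, (fingraph.root adj x), (P x + (simplex_chain 1 [set x; y] + P y)).
split; last exact: ess.
apply: (walk_cat w1); apply: (walk_cons xyA); apply: walk_rev.
by have -> := fingraph.rootP csym (connect1 xyA).
Qed.

Lemma minimal_essential_closed_walk n v c : walk n v v c -> essential c ->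
  exists L v0 c0, [/\ walk L v0 v0 c0, essential c0 &
    forall n' v' c', walk n' v' v' c' -> essential c' -> (L <= n')%N].
Proof.
elim/ltn_ind: n v c => n IH v c w ess.
have [[n' [v' [c' [ltn w' ess']]]]|no] :=
    boolp.pselect (exists n' v' c', [/\ (n' < n)%N, walk n' v' v' c' & essential c']).
  exact: IH ltn _ _ w' ess'.
exists n, v, c; split => // n' v' c' w' ess'; rewrite leqNgt; apply/negP => lt.
by apply: no; exists n', v', c'.
Qed.

(** * Edges leaving a set of vertices *)

Definition crossing (B : {set 'I_m}) : {set {set 'I_m}} :=
  [set e in simplices S 1 | #|e :&: B| == 1%N].

Lemma crossingE B x y :
  adj x y -> ([set x; y] \in crossing B) = (x \in B) (+) (y \in B).
Proof.
rewrite adj_simplex => /andP[xy xyS].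
rewrite inE xyS -sum1_card /=; under eq_bigl do rewrite inE.
by rewrite big_mkcondr big_setU1 ?inE //= big_set1; case: (x \in B); case: (y \in B).
Qed.

Lemma crossingP B e : e \in crossing B ->
  exists x y, [/\ adj x y, e = [set x; y], x \in B & y \notin B].
Proof.
move=> eB; have := eB; rewrite !inE => /andP[/andP[eS e2] _].
have /cards2P[x [y [xy exy]]] := e2.
have a : adj x y by rewrite /adj xy -exy.
have := crossingE B a; rewrite -exy eB.
case: (boolP (x \in B)) => xB; case: (boolP (y \in B)) => yB // _.
  by exists x, y.
exists y, x; split=> //; first by rewrite adj_sym.
by rewrite exy setUC.
Qed.

Definition linked (B : {set 'I_m}) : rel {set 'I_m} := fun e e' =>
  [&& e \in crossing B, e' \in crossing B &
      [exists t in S, (e \subset t) && (e' \subset t)]].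

(** The edges of the band are those crossed by a curve of the dual cell
    decomposition that runs along the frontier of B. *)
Definition band (B : {set 'I_m}) e : {set {set 'I_m}} :=
  [set e' | connect (linked B) e e'].

Lemma band_sub B e : e \in crossing B -> band B e \subset crossing B.
Proof.
move=> eB; apply/subsetP => e'; rewrite inE => /connectP[p ep ->].
by elim: p e eB ep => //= e1 p IH e eB /andP[/and3P[_ e1B _]]; exact: IH.
Qed.

(** The inner ends of two linked edges lie in a common simplex, so they are
    equal or adjacent. *)
Lemma linked_walk B e p x : e \in crossing B -> path (linked B) e p ->
  x \in e :&: B ->
  exists n y c, [/\ (n <= size p)%N, y \in last e p :&: B & walk n x y c].
Proof.
elim: p e x => [|e1 p IH] e x eB /=.
  by move=> _ xe; exists 0%N, x, 0; split => //; exact: walk_nil.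
case/andP => /and3P[_ e1B /existsP[t /and3P[tS et e1t]]] e1p xe.
have [y [z [_ e1yz yB _]]] := crossingP e1B.
have ye : y \in e1 :&: B by rewrite e1yz !inE eqxx yB.
have [n [a [c [np ae w]]]] := IH e1 y e1B e1p ye.
have [xy|xy] := eqVneq x y.
  by exists n, a, c; rewrite xy; split => //; apply: leqW.
exists n.+1, a, (simplex_chain 1 [set x; y] + c); split => //.
apply: walk_cons w; rewrite /adj xy /=; apply: cplxS.2 tS _ _.
  move: xe ye; rewrite !inE => /andP[xe _] /andP[ye _].
  by rewrite subUset !sub1set (subsetP et) // (subsetP e1t).
by apply/set0Pn; exists x; rewrite !inE eqxx.
Qed.

Definition indicator (K : {set {set 'I_m}}) : 'rV['F_2]_(code_length S) :=
  \row_j (enum_val j \in K)%:R.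

Lemma weight_indicator K : (hamming_weight (indicator K) <= #|K|)%N.
Proof.
rewrite /hamming_weight -(card_imset _ enum_val_inj) subset_leq_card //.
apply/subsetP => e /imsetP[j]; rewrite !inE mxE => + ->.
by case: (enum_val j \in K).
Qed.

Lemma indicator_simplex K s : s \in simplices S 1 ->
  simplex_chain 1 s *m (indicator K)^T = (s \in K)%:R%:M.
Proof.
move=> sS; have [j <- ->] := simplex_chainE sS.
by rewrite -rowE; apply/matrixP => a b; rewrite !ord1 !mxE.
Qed.

Lemma dotE n (a b : 'rV['F_2]_n) : dot a b = (b *m a^T) 0 0.
Proof. by rewrite !mxE; apply: eq_bigr => i _; rewrite !mxE mulrC. Qed.

(** Zero or two edges of a triangle leave B, and in the second case these two
    edges are linked, so K contains both or none of them. *)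
Lemma even_in_triangle B (K : {set {set 'I_m}}) x y z : K \subset crossing B ->
  (forall e e', e \in K -> linked B e e' -> e' \in K) ->
  [set x; y; z] \in S -> adj x y -> adj y z -> adj x z ->
  ([set x; y] \in K) (+) ([set y; z] \in K) (+) ([set x; z] \in K) = false.
Proof.
move=> KB Kc tS xy yz xz.
have xyt : [set x; y] \subset [set x; y; z] by rewrite subsetUl.
have yzt : [set y; z] \subset [set x; y; z] by rewrite setSU // subsetUr.
have xzt : [set x; z] \subset [set x; y; z] by rewrite setSU // subsetUl.
have same (e e' : {set 'I_m}) : e \subset [set x; y; z] -> e' \subset [set x; y; z] ->
    e \in crossing B -> e' \in crossing B -> (e \in K) = (e' \in K).
  have sub (f f' : {set 'I_m}) : f \subset [set x; y; z] -> f' \subset [set x; y; z] ->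
      f \in crossing B -> f' \in crossing B -> f \in K -> f' \in K.
    move=> ft ft' fB fB' fK; apply: Kc fK _; rewrite /linked fB fB' /=.
    by apply/existsP; exists [set x; y; z]; rewrite tS ft ft'.
  by move=> *; apply/idP/idP; apply: sub.
have out (e : {set 'I_m}) : e \notin crossing B -> (e \in K) = false.
  by move=> eB; apply: contraNF eB => /(subsetP KB).
have := crossingE B xy; have := crossingE B yz; have := crossingE B xz.
case: (x \in B); case: (y \in B); case: (z \in B) => /= cxz cyz cxy;
  rewrite ?(out _ (negbT cxz)) ?(out _ (negbT cyz)) ?(out _ (negbT cxy)) //.
- by rewrite (same _ _ yzt xzt cyz cxz) addbb.
- by rewrite (same _ _ xyt yzt cxy cyz) addbb.
- by rewrite addbF (same _ _ xyt xzt cxy cxz) addbb.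
- by rewrite addbF (same _ _ xyt xzt cxy cxz) addbb.
- by rewrite (same _ _ xyt yzt cxy cyz) addbb.
- by rewrite (same _ _ yzt xzt cyz cxz) addbb.
Qed.

Lemma indicator_cocycle B (K : {set {set 'I_m}}) : K \subset crossing B ->
  (forall e e', e \in K -> linked B e e' -> e' \in K) ->
  boundaries S *m (indicator K)^T = 0.
Proof.
move=> KB Kc; apply/row_matrixP => j; rewrite row0 row_mul.
have tS := enum_valP j; have [j' /enum_val_inj -> e] := simplex_chainE tS.
rewrite rowE -e boundary_simplex_chain // mulmx_suml.
have := tS; rewrite inE => /andP[tS' /eqP ct].
have [x xt] : exists x, x \in (enum_val j : {set 'I_m}).
  by apply/set0Pn; rewrite -card_gt0 ct.
have := cardsD1 x (enum_val j); rewrite ct xt add1n => -[/esym/eqP/cards2P[y [z [yz eyz]]]].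
have : y \in enum_val j :\ x by rewrite eyz !inE eqxx.
have : z \in enum_val j :\ x by rewrite eyz !inE eqxx orbT.
rewrite !inE => /andP[zx zt] /andP[yx yt].
have et : enum_val j = [set x; y; z] by rewrite -(setD1K xt) eyz setUA.
rewrite et in tS' *.
have aI a b : a \in [set x; y; z] -> b \in [set x; y; z] -> a != b -> adj a b.
  move=> ha hb ab; rewrite /adj ab /=; apply: cplxS.2 tS' _ _.
    by rewrite subUset !sub1set ha.
  by apply/set0Pn; exists a; rewrite !inE eqxx.
have xy_adj : adj x y by apply: aI; rewrite ?inE ?eqxx ?orbT // eq_sym.
have xz_adj : adj x z by apply: aI; rewrite ?inE ?eqxx ?orbT // eq_sym.
have yz_adj : adj y z by apply: aI; rewrite ?inE ?eqxx ?orbT.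
have ex : [set x; y; z] :\ x = [set y; z] by rewrite -et eyz.
have ey : [set x; y; z] :\ y = [set x; z].
  apply/setP => a; rewrite !inE; have [->|] := eqVneq a y; rewrite ?orbF //.
  by rewrite (negPf yx) (negPf yz).
have ez : [set x; y; z] :\ z = [set x; y].
  apply/setP => a; rewrite !inE; have [->|] := eqVneq a z; rewrite ?orbF //.
  by rewrite (negPf zx) eq_sym (negPf yz).
rewrite (big_setD1 x) ?inE ?eqxx //= ex big_setU1 ?inE //= big_set1 ey ez.
rewrite !indicator_simplex; first last.
- by move: yz_adj; rewrite adj_simplex => /andP[].
- by move: xz_adj; rewrite adj_simplex => /andP[].
- by move: xy_adj; rewrite adj_simplex => /andP[].
have := even_in_triangle KB Kc tS' xy_adj yz_adj xz_adj.
case: (_ \in K); case: (_ \in K); case: (_ \in K) => // _;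
  by rewrite ?raddf0 ?addr0 ?add0r // -raddfD (_ : _ + _ = 0) ?raddf0 //; apply: val_inj.
Qed.

(** A walk that stays on one side of B has no edge leaving B.  The vertices of
    the walk are described as the points at which it can be split. *)
Lemma indicator_walk0 B (K : {set {set 'I_m}}) (side : bool) n x y c : K \subset crossing B ->
  walk n x y c ->
  (forall n1 n2 z c1 c2, (n1 + n2 = n)%N -> walk n1 x z c1 -> walk n2 z y c2 ->
     c = c1 + c2 -> (z \in B) = side) ->
  c *m (indicator K)^T = 0.
Proof.
move=> KB; elim=> [t|{}n u v w {}c uv wv IH] h; first by rewrite mul0mx.
have u0 := h 0%N n.+1 u 0 _ (erefl _) (walk_nil u) (walk_cons uv wv) (esym (add0r _)).
have v0 := h 1%N n v _ _ (erefl _) (walk1 uv) wv (erefl _).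
rewrite mulmxDl IH; last first.
  move=> n1 n2 z c1 c2 e w1 w2 ec.
  apply: (h n1.+1 n2 z _ c2 _ (walk_cons uv w1) w2); first by rewrite addSn e.
  by rewrite ec addrA.
rewrite addr0 indicator_simplex; last by move: uv; rewrite adj_simplex => /andP[].
suff /negPf -> : [set u; v] \notin K by rewrite raddf0.
by apply/negP => /(subsetP KB); rewrite crossingE // u0 v0 addbb.
Qed.

(** * Balls around a vertex of a shortest essential closed walk *)

Definition ball v r : {set 'I_m} :=
  [set y | boolp.asbool (exists k c, (k <= r)%N /\ walk k v y c)].

Lemma ballP v r y :
  reflect (exists k c, (k <= r)%N /\ walk k v y c) (y \in ball v r).
Proof. by rewrite inE; exact: boolp.asboolP. Qed.

Lemma ball_mono v r1 r2 : (r1 <= r2)%N -> ball v r1 \subset ball v r2.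
Proof.
move=> r12; apply/subsetP => y /ballP[k [c [kr w]]]; apply/ballP.
by exists k, c; split => //; exact: leq_trans r12.
Qed.

Lemma ball_adj v r x y : x \in ball v r -> adj x y -> y \in ball v r.+1.
Proof.
move=> /ballP[k [c [kr w]]] xy; apply/ballP.
exists (k + 1)%N, (c + simplex_chain 1 [set x; y]).
by split; [rewrite addn1 | exact: walk_cat w (walk1 xy)].
Qed.

(** The outer end of an edge leaving the ball of radius r1 belongs to the ball
    of radius r1 + 1, hence to all larger ones. *)
Lemma crossing_disjoint v r1 r2 : (r1 < r2)%N ->
  [disjoint crossing (ball v r1) & crossing (ball v r2)].
Proof.
move=> r12; rewrite -setI_eq0; apply/set0Pn => -[e]; rewrite in_setI => /andP[].
case/crossingP => x [y [xy -> xB yB]].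
have x2 := subsetP (ball_mono v (ltnW r12)) x xB.
have y2 := subsetP (ball_mono v r12) y (ball_adj xB xy).
by rewrite crossingE // x2 y2.
Qed.

Section MinimalLoop.
Variables (L : nat) (v : 'I_m) (g : 'rV['F_2]_(code_length S)).
Hypotheses (gW : walk L v v g) (gE : essential g).
Hypothesis minL : forall n u c, walk n u u c -> essential c -> (L <= n)%N.

(** The shortcut h splits the closed walk into two closed walks, whose chains
    add up to g since h is counted twice.  One of the two is essential, hence
    has length at least L. *)
Lemma no_shortcut a b c x y g1 g2 g3 k h :
  (a + (b + c) = L)%N -> g = g1 + (g2 + g3) ->
  walk a v x g1 -> walk b x y g2 -> walk c y v g3 ->
  walk k x y h -> (minn b (a + c) <= k)%N.
Proof.
move=> eL eg w1 w2 w3 wh.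
have outer : walk (a + (k + c)) v v (g1 + (h + g3)) by exact: walk_cat w1 (walk_cat wh w3).
have inner : walk (b + k) x x (g2 + h) by exact: walk_cat w2 (walk_rev wh).
have eg' : g = (g1 + (h + g3)) + (g2 + h).
  rewrite eg -addrA; congr (_ + _); rewrite (addrC h g3) -addrA (addrA h) (addrC h g2).
  by rewrite -addrA addrr_F2 addr0 addrC.
by have := gE; rewrite eg' => /essentialD[/(minL outer)|/(minL inner)]; lia.
Qed.

(** The case of [no_shortcut] in which one of the two points is the base point. *)
Lemma loop_distance a b x g1 g2 r : (a + b = L)%N -> g = g1 + g2 ->
  walk a v x g1 -> walk b x v g2 -> x \in ball v r -> (minn a b <= r)%N.
Proof.
move=> eL eg w1 w2 /ballP[k [h [kr wh]]]; apply: leq_trans kr.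
have := @no_shortcut 0 a b v x 0 g1 g2 k h eL.
by rewrite add0r add0n; apply => //; exact: walk_nil.
Qed.

(** The heart of the proof: K is the class of the first crossing, and the two
    terms of the minimum come from whether K contains the second crossing. *)
Lemma leq_card_crossing_ball d r :
  (forall z, logical (S := S) z -> (d <= hamming_weight z)%N) ->
  (2 * r + 2 <= L)%N ->
  (minn d (minn (2 * r) (L - 2 * r)) <= #|crossing (ball v r)|)%N.
Proof.
move=> hd rL; set B := ball v r; set s := (L - 2 * r - 2)%N.
have eL : (r + (1 + (s + (1 + r))) = L)%N by rewrite /s; lia.
have eL' : (r + ((1 + (s + 1)) + r) = L)%N by lia.
have := gW; rewrite -eL => /walk_split[a [g1 [h1 [w1 + e0]]]].
case/walk_split=> [b [g2 [h2 [w2 + e1]]]].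
case/walk_split=> [b' [g3 [h3 [w3 + e2]]]].
case/walk_split=> [a' [g4 [g5 [w4 w5 e3]]]].
have eg : g = g1 + (g2 + (g3 + (g4 + g5))) by rewrite e0 e1 e2 e3.
clear h1 h2 h3 e0 e1 e2 e3.
have [ab e2] := walk1E w2; have [ba' e4] := walk1E w4.
have aB : a \in B by apply/ballP; exists r, g1.
have a'B : a' \in B by apply/ballP; exists r, g5; split => //; exact: walk_rev.
have outside n1 n2 z c1 c2 : (n1 + n2 = s)%N -> walk n1 b z c1 -> walk n2 z b' c2 ->
    g3 = c1 + c2 -> (z \in B) = false.
  move=> es u1 u2 eg3; apply/negP => zB.
  have eLz : ((r + (1 + n1)) + (n2 + (1 + r)) = L)%N by lia.
  have egz : g = (g1 + (g2 + c1)) + (c2 + (g4 + g5)) by rewrite eg eg3 !addrA.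
  have := loop_distance eLz egz (walk_cat w1 (walk_cat w2 u1))
    (walk_cat u2 (walk_cat w4 w5)) zB.
  lia.
(* The two ends of the middle arc are reached by its empty initial and final parts. *)
have bB := outside 0%N s b 0 g3 (add0n s) (walk_nil b) w3 (esym (add0r g3)).
have b'B := outside s 0%N b' g3 0 (addn0 s) w3 (walk_nil b') (esym (addr0 g3)).
have eB : [set a; b] \in crossing B by rewrite crossingE // aB bB.
have e'B : [set b'; a'] \in crossing B by rewrite crossingE // a'B b'B.
pose K := band B [set a; b].
have KB : K \subset crossing B := band_sub eB.
have Kc e e' : e \in K -> linked B e e' -> e' \in K.
  by rewrite !inE => eK ee'; apply: connect_trans eK (connect1 ee').
apply: leq_trans (subset_leq_card KB).
have eg' : g = g1 + ((g2 + (g3 + g4)) + g5) by rewrite eg !addrA.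
have [e'K|e'K] := boolP ([set b'; a'] \in K).
  (* A simple chain of linked edges joins both crossings: it gives a walk from a to a'. *)
  move: e'K; rewrite inE => /connectP[p0 p0P last0].
  have := last0; case: (shortenP p0P) => p pP pU _ lastp.
  have pK : (size p < #|K|)%N.
    rewrite -[(size p).+1]/(size ([set a; b] :: p)) -(card_uniqP pU).
    apply/subset_leq_card/subsetP => f fp.
    by rewrite inE; exact: (path_connect pP).
  have aE : a \in [set a; b] :&: B by rewrite in_setI set21.
  have [n [y [c [np + wy]]]] := linked_walk eB pP aE.
  rewrite -lastp => yE.
  have ya : y = a'.
    move: yE; rewrite in_setI in_set2 => /andP[/orP[]/eqP -> //].
    by rewrite b'B.
  rewrite {}ya in wy.
  have := no_shortcut eL' eg' w1 (walk_cat w2 (walk_cat w3 w4)) w5 wy.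
  move: np pK; clear -eL; move: (size p) #|K| => sp cK; lia.
(* K meets the closed walk only in its first crossing: its indicator is logical. *)
apply: leq_trans (geq_minl _ _) _; apply: leq_trans (weight_indicator K).
apply: hd; apply/orP; right; apply/andP; split.
  apply/forallP => z; apply/implyP => /submxP[u ->].
  by rewrite dotE -mulmxA (indicator_cocycle KB Kc) mulmx0 mxE.
have inside : g1 *m (indicator K)^T = 0.
  apply: (indicator_walk0 (side := true) KB w1) => n1 n2 z c1 c2 e u1 _ _.
  by apply/ballP; exists n1, c1; split => //; rewrite -e leq_addr.
have inside' : g5 *m (indicator K)^T = 0.
  apply: (indicator_walk0 (side := true) KB w5) => n1 n2 z c1 c2 e _ u2 _.
  by apply/ballP; exists n2, c2; split; [rewrite -e leq_addl | exact: walk_rev].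
have mid : g3 *m (indicator K)^T = 0 by apply: (indicator_walk0 (side := false) KB w3).
have pg : dot (indicator K) g = 1.
  rewrite dotE eg !mulmxDl inside inside' mid e2 e4 !indicator_simplex.
  - by rewrite (negPf e'K) inE connect0 raddf0 !addr0 add0r mxE.
  - by move: ba'; rewrite adj_simplex => /andP[].
  - by move: ab; rewrite adj_simplex => /andP[].
apply/forallP => /(_ g)/implyP; rewrite pg => h.
have /h : (g <= cycles S)%MS.
  by apply/sub_kermxP; rewrite (boundary_walk gW) addrr_F2.
by [].
Qed.

Lemma sum_card_crossing_ball k (F : 'I_k -> nat) : injective F ->
  (\sum_(i < k) #|crossing (ball v (F i))| <= code_length S)%N.
Proof.
move=> Finj; under eq_bigr do rewrite -sum1_card.
rewrite -(partition_disjoint_bigcup _ (fun=> 1%N)) => [|i j ij].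
  rewrite sum1_card subset_leq_card //.
  apply/subsetP => e /bigcupP[i _]; rewrite inE => /andP[eS _]; exact: eS.
have : F i != F j by rewrite (inj_eq Finj).
rewrite neq_ltn => /orP[]; last rewrite disjoint_sym; exact: crossing_disjoint.
Qed.

(** For radii between q and 2q with 6q <= d <= L, each of d, 2r and L - 2r is at
    least 2q, so these q disjoint sets of edges have at least 2q elements each. *)
Lemma leq_code_length_loop d :
  (forall z, logical (S := S) z -> (d <= hamming_weight z)%N) ->
  (d <= L)%N -> (2 * (d %/ 6) ^ 2 <= code_length S)%N.
Proof.
move=> hd dL; set q := (d %/ 6)%N.
have qd : (6 * q <= d)%N by rewrite mulnC; exact: leq_divM.
have Finj : injective (fun i : 'I_q => (q + i)%N) by move=> i j /addnI /val_inj.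
apply: leq_trans (sum_card_crossing_ball Finj).
have -> : (2 * q ^ 2 = \sum_(i < q) 2 * q)%N by rewrite sum_nat_const card_ord; lia.
apply: leq_sum => i _; have iq := ltn_ord i.
have h : (2 * (q + i) + 2 <= L)%N by lia.
by have := leq_card_crossing_ball hd h; lia.
Qed.

End MinimalLoop.

(** * The bound on the distance *)

Lemma essential_cycle : dim_H1 S <> 0%N ->
  exists2 z : 'rV_(code_length S), (z <= cycles S)%MS & essential z.
Proof.
move=> H1.
have /row_subPn[i zi] : ~~ (cycles S <= boundaries S)%MS.
  by apply/negP => /mxrankS h; apply: H1; apply/eqP.
by exists (row i (cycles S)); first exact: row_sub.
Qed.

(** The neutral value of the minimum is not a unit for it on all natural numbers,
    so the minimum is unfolded along the enumeration. *)
Lemma leq_code_distance z : logical (S := S) z -> (code_distance S <= hamming_weight z)%N.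
Proof.
move=> lz; rewrite /code_distance.
have : z \in index_enum _ by exact: mem_index_enum.
elim: (index_enum _) => // a l IH; rewrite inE big_cons => /predU1P[<-|/IH zl].
  by rewrite lz geq_minl.
by case: ifP => // _; apply: leq_trans (geq_minr _ _) zl.
Qed.

(** With d = 6q + r and r <= 5: if q > 0 then d <= 11q, and 2 q^2 <= n gives the
    constant 121; if q = 0 then d <= 5, and d <= n is enough. *)
Lemma code_distance_bound : dim_H1 S <> 0%N ->
  (code_distance S ^ 2 <= 121 * code_length S)%N.
Proof.
case/essential_cycle => z zZ zE.
have [n [v [c [w cE]]]] := essential_closed_walk zZ zE.
have [L [v0 [g [gW gE minL]]]] := minimal_essential_closed_walk w cE.
have gl : logical (S := S) g.
  apply/orP; left; rewrite [X in _ && X]gE andbT; apply/sub_kermxP.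
  by rewrite (boundary_walk gW) addrr_F2.
set d := code_distance S.
have dw : (d <= hamming_weight g)%N := leq_code_distance gl.
have dn : (d <= code_length S)%N.
  by apply: leq_trans dw _; rewrite -[X in (_ <= X)%N]card_ord; exact: max_card.
have dL : (d <= L)%N := leq_trans dw (weight_walk gW).
have := leq_code_length_loop gW gE minL leq_code_distance dL.
rewrite -/d; have := divn_eq d 6; have := ltn_pmod d (isT : 0 < 6)%N.
set q := (d %/ 6)%N; set r := (d %% 6)%N => r6 dE h.
case: (posnP q) => [q0|q0].
  have d5 : (d <= 5)%N by lia.
  by apply: leq_trans (leq_mul d5 dn) _; rewrite leq_mul2r orbT.
have dq : (d <= 11 * q)%N by lia.
have := leq_mul dq dq; nia.
Qed.

End Complex.

Local Open Scope classical_set_scope.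
Theorem theorem0p3 (R : realType) :
  exists C : R, 0 < C /\
    forall (M : topologicalType) (m : nat) (S : {set {set 'I_m}}),
      compact_surface R M -> connected [set: M] ->
      triangulation R M S ->
      dim_H1 S <> 0%N ->
      forall n k d : nat, homological_code_parameters S = (n, k, d) ->
        d%:R ^+ 2 <= C * n%:R.
Proof.
exists 121%:R; split; first by rewrite ltr0n.
move=> M m S _ _ [cplxS _] H1 n k d [<- _ <-].
by rewrite -natrX -natrM ler_nat; exact: code_distance_bound.
Qed.
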